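(* Let $p$ and $q$ be two odd prime numbers with $p < q$. Then the Sombor index of the unit graph $G(\mathbb{Z}_{pq})$ is $$SO(G(\mathbb{Z}_{pq})) = \sqrt{2}\,\alpha\,\phi(pq) + \beta\sqrt{(\phi(pq))^2+(\phi(pq)-1)^2} + \sqrt{2}\,(|E|-\alpha-\beta)(\phi(pq)-1),$$ where $$\alpha = (p-1)(q-1), \qquad \beta = (p-1)(q-1)(p+q-3), \qquad |E| = \frac{(pq-1)\phi(pq)}{2}.$$
   Context: For a finite simple graph $G$, the Sombor index is $SO(G)=\sum_{uv\in E(G)}\sqrt{d_u^2+d_v^2}$, the sum being over (unordered) edges, where $d_x$ is the degree of the vertex $x$. For a commutative ring $R$ with unity, $U(R)$ denotes the set of units of $R$. The unit graph $G(R)$ is the simple graph whose vertices are all elements of $R$, with distinct vertices $x,y$ adjacent if and only if $x+y\in U(R)$. $\mathbb{Z}_n$ is the ring of integers modulo $n$ and $\phi$ is Euler's totient function. *)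

(* Defs.v *)
From HB Require Import structures.
From mathcomp Require Import all_boot all_order all_algebra.
Set Implicit Arguments.
Unset Strict Implicit.
Unset Printing Implicit Defensive.
Import Order.TTheory GRing.Theory Num.Theory.
Local Open Scope ring_scope.

Record sgraph (T : finType) := SGraph {
  adj :> rel T;
  adj_sym : symmetric adj;
  adj_irr : irreflexive adj }.

Definition degree (T : finType) (G : sgraph T) (x : T) : nat :=
  #|[set y | G x y]|.

Definition edges (T : finType) (G : sgraph T) : {set {set T}} :=
  [set [set u.1; u.2] | u : T * T & G u.1 u.2].

(* An edge e = [set u; v] has exactly two elements, u != v, so the inner sum
   is d_u ^ 2 + d_v ^ 2. *)
Definition sombor (K : rcfType) (T : finType) (G : sgraph T) : K :=
  \sum_(e in edges G) Num.sqrt (\sum_(v in e) (degree G v)%:R ^+ 2).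

Section UnitGraph.
Variable R : finComUnitRingType.

Definition unit_adj : rel R :=
  fun x y => (x != y) && (x + y \is a GRing.unit).

Lemma unit_adj_sym : symmetric unit_adj.
Proof. by move=> x y; rewrite /unit_adj eq_sym addrC. Qed.

Lemma unit_adj_irr : irreflexive unit_adj.
Proof. by move=> x; rewrite /unit_adj eqxx. Qed.

Definition unit_graph : sgraph R := SGraph unit_adj_sym unit_adj_irr.
End UnitGraph.

(* Main.v *)
(* Twice a sum over edges is the sum over ordered adjacent pairs. Since 2 is a
   unit, a unit of Z_pq has degree phi - 1 and a non-unit has degree phi, so an
   edge contributes according to the number of units among its endpoints.
   Counting the degrees of the units and of the non-units gives the numbers of
   edges of each kind once the non-unit--non-unit edges are known; those join a
   nonzero multiple of p to a nonzero multiple of q. *)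
Require Import Defs.
From HB Require Import structures.
From mathcomp Require Import all_boot all_order all_algebra.
From mathcomp Require Import zify ring lra.
Set Implicit Arguments.
Unset Strict Implicit.
Unset Printing Implicit Defensive.
Import Order.TTheory GRing.Theory Num.Theory.
Local Open Scope ring_scope.

(** * Edges and ordered adjacent pairs *)

Lemma sum_adj (K : pzSemiRingType) (T : finType) (G : sgraph T)
    (F : {set T} -> K) :
  \sum_(z : T * T | G z.1 z.2) F [set z.1; z.2]
  = (\sum_(e in edges G) F e) *+ 2.
Proof.
rewrite (partition_big (fun z : T * T => [set z.1; z.2]) [in edges G]) /=;
  last by move=> z Gz; rewrite /edges; apply/imsetP; exists z; rewrite ?inE.
rewrite -sumrMnl; apply: eq_bigr => _ /imsetP[[x y] /= Gxy ->].
rewrite inE in Gxy.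
have neq_xy : x != y by apply: contraTneq Gxy => ->; rewrite (adj_irr G).
rewrite (eq_bigr (fun=> F [set x; y])) => [|z /andP[_ /eqP -> //]].
rewrite sumr_const; congr (_ *+ _).
(* The fibre over an edge consists of its two orientations, distinct since there are no loops. *)
have -> : 2%N = #|[set (x, y); (y, x)]|.
  by rewrite cards2 xpair_eqE (negPf neq_xy).
apply: eq_card => -[a b]; rewrite !inE /= !xpair_eqE.
apply/andP/orP => [[Gab /eqP eq_ab]|[] /andP[/eqP -> /eqP ->]]; last first.
- by split; [rewrite (adj_sym G) | rewrite setUC].
- by split.
have neq_ab : a != b by apply: contraTneq Gab => ->; rewrite (adj_irr G).
have : a \in [set x; y] by rewrite -eq_ab set21.
have : b \in [set x; y] by rewrite -eq_ab set22.
by rewrite !inE; do 2!case/orP=> /eqP ?; subst;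
  rewrite ?eqxx in neq_ab *; auto.
Qed.

Section AdjacencyCount.
Variables (T : finType) (G : sgraph T).
Implicit Types A B : pred T.

(** Pairs are ordered: an edge inside [A] counts twice in [adj_count A A], an edge leaving [A] once
    in [adj_count A (predC A)]. *)
Definition adj_count A B : nat :=
  #|[set z : T * T | [&& G z.1 z.2, A z.1 & B z.2]]|.

Lemma adj_countC A B : adj_count A B = adj_count B A.
Proof.
have swap_inj : injective (fun z : T * T => (z.2, z.1)).
  by move=> [a b] [c d] [-> ->].
rewrite /adj_count -(card_imset _ swap_inj).
apply: eq_card => -[x y]; apply/imsetP/idP => [[[a b]]|].
  by rewrite !inE /= => /and3P[Gab Aa Bb] [-> ->]; rewrite (adj_sym G) Gab Bb.
rewrite !inE /= => /and3P[Gxy Bx Ay]; exists (y, x) => //.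
by rewrite inE /= (adj_sym G) Gxy Bx Ay.
Qed.

Lemma adj_count_degree A B :
  (adj_count A B + adj_count A (predC B) = \sum_(x | A x) degree G x)%N.
Proof.
have -> : (\sum_(x | A x) degree G x =
           #|[set z : T * T | G z.1 z.2 && A z.1]|)%N.
  rewrite -sum1_card (eq_bigl (fun z : T * T => A z.1 && G z.1 z.2)) => [|z].
    rewrite -(pair_big_dep A G (fun _ _ => 1%N)) /=.
    by apply: eq_bigr => x _; rewrite sum1_card /degree cardsE.
  by rewrite inE andbC.
rewrite -(cardsID [set z : T * T | B z.2] [set z : T * T | G z.1 z.2 && A z.1]).
by congr (_ + _)%N; apply: eq_card => z; rewrite !inE /=;
  case: (G _ _); case: (A _); case: (B _).
Qed.

(** Serves twice below: with the Sombor weight, which depends only on which endpoints are units, and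
    with the constant 1 to count edges. *)
Lemma sum_adj_bool (K : pzSemiRingType) A (f : bool -> bool -> K) :
  \sum_(z : T * T | G z.1 z.2) f (A z.1) (A z.2) =
    f true true *+ adj_count A A + f true false *+ adj_count A (predC A)
    + (f false true *+ adj_count (predC A) A
       + f false false *+ adj_count (predC A) (predC A)).
Proof.
rewrite (bigID (fun z : T * T => A z.1)) /=.
rewrite (bigID (fun z : T * T => A z.2)) /=.
rewrite [in X in _ + X](bigID (fun z : T * T => A z.2)) /=.
rewrite /adj_count -!sumr_const.
congr (_ + _ + (_ + _)); apply: eq_big => z;
  by rewrite ?inE /=; case: (G _ _); case: (A _); case: (A _).
Qed.

End AdjacencyCount.

(** * Unit graphs of finite rings in which 2 is invertible *)

Section UnitGraphCount.
Variable R : finComUnitRingType.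
Hypothesis unit2 : (2%:R : R) \is a GRing.unit.
Let isunit : pred R := fun x => x \is a GRing.unit.
Let G := unit_graph R.

(** Translation by [- x] maps the units onto the neighbours of [x], together with [x] itself exactly
    when [2 * x] is a unit, that is, when [x] is. *)
Lemma degree_unit_graph (x : R) :
  (degree G x + (x \is a GRing.unit) = #|isunit|)%N.
Proof.
rewrite -(card_imset isunit (addrI (- x))).
rewrite (cardsD1 x) addnC; congr (_ + _)%N.
  congr (nat_of_bool _); apply/idP/imsetP => [ux|[y uy def_x]].
    exists (x + x); last by rewrite addKr.
    by rewrite unfold_in /isunit -mulr2n -mulr_natl unitrM unit2.
  have : 2%:R * x \is a GRing.unit.
    by rewrite mulr_natl mulr2n {1}def_x addrAC addNr add0r.
  by rewrite unitrM unit2.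
apply: eq_card => y; rewrite !inE /= /unit_adj eq_sym; congr (_ && _).
apply/idP/imsetP => [uxy|[z uz ->]]; first by exists (x + y) => //; rewrite addKr.
by rewrite addrA subrr add0r.
Qed.

Lemma adj_count_unit_l :
  (adj_count G isunit isunit + adj_count G isunit (predC isunit)
   = #|isunit| * #|isunit|.-1)%N.
Proof.
rewrite adj_count_degree -sum_nat_const; apply: eq_bigr => x ux.
by rewrite -(degree_unit_graph x) [x \is a _]ux addn1.
Qed.

Lemma adj_count_nonunit_l :
  (adj_count G (predC isunit) isunit
   + adj_count G (predC isunit) (predC isunit)
   = (#|R| - #|isunit|) * #|isunit|)%N.
Proof.
rewrite -(cardC isunit) addKn.
rewrite adj_count_degree -sum_nat_const; apply: eq_bigr => x /negPf nux.
by rewrite -(degree_unit_graph x) [x \is a _]nux addn0.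
Qed.

(** A pair of vertices of equal degree [d] contributes [Num.sqrt (2 * d ^+ 2)], which is
    [Num.sqrt 2 * d]; mixed pairs occur in both orders, hence the doubled count. *)
Lemma sombor_unit_graph (K : rcfType) (u := #|isunit|%:R : K) :
  sombor K G *+ 2 =
    Num.sqrt 2%:R * (u - 1) *+ adj_count G isunit isunit
    + Num.sqrt (u ^+ 2 + (u - 1) ^+ 2) *+ (adj_count G isunit (predC isunit)).*2
    + Num.sqrt 2%:R * u *+ adj_count G (predC isunit) (predC isunit).
Proof.
pose d (b : bool) : K := u - b%:R.
(* Makes [u - 1] nonnegative, so the roots of squares below need no absolute value. *)
have u_ge1 : 1 <= u.
  rewrite ler1n; apply/card_gt0P; exists 1; exact: unitr1.
have degE x : (degree G x)%:R = d (isunit x).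
  by rewrite /d /u -(degree_unit_graph x) natrD addrK.
rewrite /sombor -sum_adj.
under eq_bigr => z Gz.
  have neq_z : z.1 \notin [set z.2].
    by rewrite inE; case/andP: Gz.
  rewrite (big_setU1 _ neq_z) big_set1 /= !degE.
  over.
rewrite (sum_adj_bool G isunit (fun b c => Num.sqrt (d b ^+ 2 + d c ^+ 2))).
rewrite [adj_count G (predC isunit) isunit]adj_countC /d subr0.
rewrite [u ^+ 2 + (u - _) ^+ 2]addrC -!mulr2n -![_ ^+ 2 *+ 2]mulr_natl.
rewrite !(sqrtrM _ (ler0n K 2)) !sqrtr_sqr !ger0_norm ?subr_ge0 //.
by rewrite -addnn mulrnDr !addrA.
Qed.

(** Handshake count: with [u] units among [N] elements, the degrees add up to
    [u * (u - 1) + (N - u) * u = N * u - u]. *)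
Lemma card_edges_unit_graph :
  (#|edges G|.*2 + #|isunit| = #|R| * #|isunit|)%N.
Proof.
have /esym := sum_adj G (fun=> 1 : int); rewrite sumr_const.
rewrite (sum_adj_bool G isunit (fun _ _ => 1)) => e.
have u_gt0 : (0 < #|isunit|)%N by apply/card_gt0P; exists 1; exact: unitr1.
rewrite -!mulrnDr -mulrnA in e; move/eqP: e; rewrite eqr_nat => /eqP e.
rewrite -muln2 e adj_count_unit_l adj_count_nonunit_l.
rewrite -(cardC isunit) addKn mulnDl.
by rewrite addnAC -mulnSr prednK.
Qed.
End UnitGraphCount.

(** * Units and non-units of the ring of integers modulo [p * q] *)

Lemma card_dvd_ord (m n N : nat) : (0 < m)%N -> N = (n * m)%N ->
  #|[set x : 'I_N | (m %| x)%N]| = n.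
Proof.
move=> m0 ->{N}.
have lt_im (i : 'I_n) : (i * m < n * m)%N by rewrite ltn_pmul2r.
pose f i := Ordinal (lt_im i).
have f_inj : injective f.
  by move=> i j /(congr1 val)/= /eqP; rewrite eqn_pmul2r // => /eqP/val_inj.
rewrite -[RHS]card_ord -(card_imset predT f_inj).
apply: eq_card => x; rewrite inE; apply/idP/imsetP => [dvd_x|[i _ ->]].
  have lt_x : (x %/ m < n)%N by rewrite ltn_divLR.
  by exists (Ordinal lt_x) => //; apply: val_inj; rewrite /= divnK.
exact: dvdn_mull.
Qed.

Section TwoPrimes.
Variables (p q : nat).
Hypotheses (p_prime : prime p) (q_prime : prime q) (neq_pq : p != q).
Let R : finComUnitRingType := 'Z_(p * q).
Let isunit : pred R := fun x => x \is a GRing.unit.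
Let multp := [set x : R | (p %| x)%N].
Let multq := [set x : R | (q %| x)%N].

Let pq_gt1 : (1 < p * q)%N.
Proof.
by rewrite (leq_trans (prime_gt1 p_prime)) // leq_pmulr // prime_gt0.
Qed.

Let coprime_pq : coprime p q.
Proof. by rewrite prime_coprime // dvdn_prime2. Qed.

Lemma isunit_Zpq (x : R) : isunit x = (x \notin multp) && (x \notin multq).
Proof.
rewrite !inE /isunit -[x in x \is a _]natr_Zp unitZpE //.
by rewrite coprimeMl !prime_coprime.
Qed.

(** Reduction modulo [p * q] preserves divisibility by a divisor of [p * q]. *)
Lemma dvdn_Zpq_add (d : nat) (x y : R) : (d %| p * q)%N ->
  (d %| (x + y)%R)%N = (d %| x + y)%N.
Proof.
by move=> d_pq; rewrite /dvdn modn_dvdm ?Zp_cast.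
Qed.

Let card_multp : #|multp| = q.
Proof. by apply: card_dvd_ord; rewrite ?prime_gt0 // Zp_cast // mulnC. Qed.

Let card_multq : #|multq| = p.
Proof. by apply: card_dvd_ord; rewrite ?prime_gt0 // Zp_cast. Qed.

Let card_multpq : #|multp :&: multq| = 1%N.
Proof.
have defN : (Zp_trunc (p * q)).+2 = (1 * (p * q))%N by rewrite mul1n Zp_cast.
rewrite -[RHS](card_dvd_ord (ltnW pq_gt1) defN).
by apply: eq_card => x; rewrite !inE Gauss_dvd.
Qed.

Lemma card_Zpq : #|R| = (p * q)%N.
Proof. by rewrite card_ord Zp_cast. Qed.

(** Inclusion-exclusion: [p * q - (p + q - 1)] residues avoid both primes. *)
Lemma card_isunit_Zpq : #|isunit| = (p.-1 * q.-1)%N.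
Proof.
have -> : #|isunit| = #|~: (multp :|: multq)|.
  by apply: eq_card => x; rewrite !inE [LHS]isunit_Zpq !inE negb_or.
have := cardsC (multp :|: multq); rewrite cardsU card_multp card_multq.
rewrite card_multpq card_Zpq.
have := prime_gt1 p_prime; have := prime_gt1 q_prime; nia.
Qed.

(** If a prime divides both endpoints it divides their sum, so in an adjacent pair of non-units one
    is divisible by [p] only and the other by [q] only; such a sum is indeed prime to both. [S] and
    [S'] are the two orders. *)
Lemma adj_count_nonunit_Zpq :
  adj_count (unit_graph R) (predC isunit) (predC isunit)
  = (p.-1 * q.-1).*2.
Proof.
pose S := setX (multp :\: multq) (multq :\: multp).
pose S' := setX (multq :\: multp) (multp :\: multq).
have cardS : #|S| = (p.-1 * q.-1)%N.
  rewrite cardsX !cardsD [multq :&: _]setIC card_multpq card_multp card_multq.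
  by rewrite !subn1 mulnC.
have cardS' : #|S'| = (p.-1 * q.-1)%N by rewrite cardsX mulnC -cardsX.
have disj : S :&: S' = set0.
  apply/setP => -[x y]; rewrite !inE /=.
  by do 4!case: (_ %| _)%N.
rewrite -addnn -{1}cardS -cardS' -cardsUI disj cards0 addn0.
apply: eq_card => -[x y].
rewrite !inE /= [isunit x]isunit_Zpq [isunit y]isunit_Zpq /unit_adj !inE.
rewrite [x + y \is a _]isunit_Zpq !inE.
rewrite (dvdn_Zpq_add _ _ (dvdn_mulr q (dvdnn p))).
rewrite (dvdn_Zpq_add _ _ (dvdn_mull p (dvdnn q))).
(* On the diagonal both sides fail: no element is at once a multiple of [p] only and of [q] only. *)
have [<-|_] /= := eqVneq x y; first by do 2!case: (_ %| _)%N.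
(* c is arbitrary: it matters only when d divides neither summand. *)
have dvd_add d : exists c,
    (d %| x + y)%N = if (d %| x)%N then (d %| y)%N else ~~ (d %| y)%N && c.
  exists (d %| x + y)%N; case: ifP => [dx|ndx]; first exact: dvdn_addr.
  by case: (boolP (d %| y)%N) => //= dy; rewrite dvdn_addl.
have [[c ->] [c' ->]] := (dvd_add p, dvd_add q).
by do 4!case: (_ %| _)%N; case: c; case: c'.
Qed.

End TwoPrimes.

(** * Evaluation of the three edge counts and of the index *)

Theorem theorem4p2 (K : rcfType) (p q : nat)
    (p_prime : prime p) (q_prime : prime q)
    (p_odd : odd p) (q_odd : odd q) (lt_pq : (p < q)%N) :
  let G := unit_graph 'Z_(p * q) in
  let phi : K := (totient (p * q))%:R in
  let alpha : K := (p%:R - 1) * (q%:R - 1) in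
  let beta : K := (p%:R - 1) * (q%:R - 1) * (p%:R + q%:R - 3%:R) in
  let E : K := ((p * q)%:R - 1) * phi / 2%:R in
  #|edges G|%:R = E /\
  sombor K G =
    Num.sqrt 2%:R * alpha * phi
    + beta * Num.sqrt (phi ^+ 2 + (phi - 1) ^+ 2)
    + Num.sqrt 2%:R * (E - alpha - beta) * (phi - 1).
Proof.
move=> G phi alpha beta E.
have neq_pq : p != q by rewrite ltn_eqF.
have p_gt1 := prime_gt1 p_prime; have q_gt1 := prime_gt1 q_prime.
have unit2 : (2%:R : 'Z_(p * q)) \is a GRing.unit.
  rewrite unitZpE; last nia.
  by rewrite coprime_sym coprime2n oddM p_odd.
have card_R := card_Zpq p_prime q_prime.
have card_U := card_isunit_Zpq p_prime q_prime neq_pq.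
have totE : totient (p * q) = (p.-1 * q.-1)%N.
  rewrite totient_coprime ?totient_prime //.
  by rewrite prime_coprime // dvdn_prime2.
have card_E := card_edges_unit_graph unit2.
(* The number [alpha] of edges between non-units happens to equal the number of units. *)
have alphaE : phi = alpha.
  by rewrite /phi /alpha totE natrM -!subn1 !natrB // ltnW.
have EE : #|edges G|%:R = E.
  have /(congr1 (fun n => n%:R : K)) := card_E.
  rewrite card_R card_U -totE natrD -muln2 !natrM -/phi => e.
  rewrite /E natrM; lra.
split=> //.
have N00 := adj_count_nonunit_Zpq p_prime q_prime neq_pq.
have N0 := adj_count_nonunit_l unit2; have N1 := adj_count_unit_l unit2.
have SO2 : sombor K G *+ 2 = _ := sombor_unit_graph unit2 K.
rewrite adj_countC in N0.
rewrite card_R !card_U -totE N00 -/phi /= in N0 N1 SO2.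
move: N0 N1 SO2; set n01 := adj_count _ _ _; set n11 := adj_count _ _ _.
move: n01 n11 (sombor K G) => n01 n11 SO N0 N1.
(* These bounds let the truncated subtractions in [N0] and [N1] be cast to [K]. *)
have le_tot : (totient (p * q) <= p * q)%N by rewrite totE leq_mul ?leq_pred.
have tot_gt0 : (0 < totient (p * q))%N by rewrite totient_gt0 muln_gt0 (ltnW p_gt1) ltnW.
(* The [p + q - 1] non-units have degree [phi]; removing the [2 * alpha] ordered pairs of non-units
   leaves the mixed edges. *)
have n01E : n01%:R = beta.
  have /(congr1 (fun n => n%:R : K)) := N0.
  rewrite natrD -totE -muln2 !natrM natrB // -/phi natrM alphaE => e.
  rewrite -[LHS](addrK (alpha * 2%:R)) e /alpha /beta; ring.
(* The edges between units are the remaining ones, each counted in both orders. *)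
have n11E : n11%:R = 2%:R * (E - alpha - beta).
  have /(congr1 (fun n => n%:R : K)) := N1.
  rewrite natrD natrM -subn1 natrB // -/phi n01E alphaE => e.
  by rewrite -[LHS](addrK beta) e /E alphaE natrM /alpha /beta; field.
move=> SO2; apply: (mulIf (_ : 2%:R != 0 :> K)); first by rewrite pnatr_eq0.
rewrite mulr_natr SO2 -!(mulr_natr (_ * _)) -(mulr_natr (Num.sqrt _)) n11E.
by rewrite -!muln2 !natrM n01E -natrM -totE -/phi alphaE; ring.
Qed.
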